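(* Every $\Delta^*_{\mathrm{ip}}$-transitive operator $T\colon X\to X$ is mildly mixing.
   Context: $\mathbb{N}_0$ is the set of non-negative integers. An operator $T\colon X\to X$ is a continuous linear self-map of an infinite-dimensional separable Fréchet space $X$ over $\mathbb{R}$ or $\mathbb{C}$. $T$ is hypercyclic if some vector has dense orbit under $T$. $T$ is mildly mixing if $T\oplus S$ is hypercyclic for every hypercyclic operator $S\colon Y\to Y$. For a sequence $(x_n)_{n\in\mathbb{N}}$ in $\mathbb{N}_0$, $\operatorname{FS}((x_n)_n)=\{x_{i_1}+\dots+x_{i_m}: i_1<\dots<i_m,\ m\in\mathbb{N}\}$. A set $A\subset\mathbb{N}_0$ is an IP-set if $\operatorname{FS}((x_n)_n)\subset A$ for some sequence $(x_n)_n$ in $\mathbb{N}_0$ with infinitely many non-zero terms; $\mathcal{F}_{\mathrm{ip}}$ is the family of IP-sets. $\Delta_{\mathrm{ip}}$ is the collection of sets of the form $(F-F)\cap\mathbb{N}_0$ with $F\in\mathcal{F}_{\mathrm{ip}}$, where $F-F=\{m-n: m,n\in F,\ m\neq n\}$. $\Delta^*_{\mathrm{ip}}$ is the collection of all $A\subset\mathbb{N}_0$ with $A\cap B\ne\emptyset$ for every $B\in\Delta_{\mathrm{ip}}$. $T$ is $\Delta^*_{\mathrm{ip}}$-transitive if $N_T(U,V)=\{n\in\mathbb{N}_0: T^nU\cap V\neq\emptyset\}\in\Delta^*_{\mathrm{ip}}$ for all non-empty open $U,V\subset X$. *)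

(* Defs.v *)
From HB Require Import structures.
From mathcomp Require Import all_boot all_order all_algebra.
From mathcomp Require Import complex.
From mathcomp Require Import all_classical all_reals all_analysis.

Set Implicit Arguments.
Unset Strict Implicit.
Unset Printing Implicit Defensive.
Import Order.TTheory GRing.Theory Num.Theory.
Import numFieldNormedType.Exports.

Local Open Scope classical_set_scope.
Local Open Scope ring_scope.

Definition real_or_complex (R : realType) (K : numFieldType) : Prop :=
  K = R \/ K = R[i]%C.

Definition is_metric (R : realType) (X : Type) (d : X -> X -> R) : Prop :=
  [/\ forall x y, 0 <= d x y,
      forall x y, d x y = 0 <-> x = y,
      forall x y, d x y = d y x &
      forall x y z, d x z <= d x y + d y z].

(* A [tvsType] is locally convex, but neither Hausdorff nor metrizable nor
   complete by definition, and its uniform structure is only required to induce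
   the topology, not to be the translation-invariant one. Completeness is
   therefore stated with a translation-invariant metric inducing the topology
   and not with the uniform structure. *)
Definition frechet (R : realType) (K : numFieldType) (X : tvsType K) : Prop :=
  exists d : X -> X -> R,
    [/\ is_metric d,
        forall x y z, d (x + z) (y + z) = d x y,
        forall (x : X) (A : set X),
          nbhs x A <-> exists2 e : R, 0 < e & [set y | d x y < e] `<=` A &
        forall u : nat -> X,
          (forall e : R, 0 < e -> exists N : nat, forall m n : nat,
             (N <= m)%N -> (N <= n)%N -> d (u m) (u n) < e) ->
          exists l : X, u @ \oo --> l].

Definition separable (X : topologicalType) : Prop :=
  exists2 D : set X, countable D & dense D.

Definition infinite_dimensional (K : numFieldType) (X : lmodType K) : Prop :=
  ~ exists (n : nat) (e : 'I_n -> X),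
      forall x : X, exists c : 'I_n -> K, x = \sum_(i < n) c i *: e i.

Definition operator_space (R : realType) (K : numFieldType) (X : tvsType K) :
    Prop :=
  [/\ frechet R X, separable X & infinite_dimensional X].

Definition hypercyclic (X : topologicalType) (T : X -> X) : Prop :=
  exists x : X, dense [set iter n T x | n in [set: nat]].

Definition direct_sum (X Y : Type) (T : X -> X) (S : Y -> Y) : X * Y -> X * Y :=
  fun z => (T z.1, S z.2).

Definition mildly_mixing (R : realType) (K : numFieldType) (X : tvsType K)
    (T : X -> X) : Prop :=
  forall (Y : tvsType K) (S : {linear Y -> Y}),
    operator_space R Y -> continuous S -> hypercyclic S ->
    hypercyclic (direct_sum T S).

(* The index list [i_1; ...; i_m] is nonempty and strictly increasing; indices
   start at 0. *)
Definition FS (x : nat -> nat) : set nat :=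
  [set k | exists2 s : seq nat, s != [::] /\ sorted ltn s &
                                k = (\sum_(i <- s) x i)%N].

Definition ip_set (A : set nat) : Prop :=
  exists2 x : nat -> nat, infinite_set [set n | x n != 0%N] & FS x `<=` A.

Definition difference_set (F : set nat) : set int :=
  [set k | exists m n : nat, [/\ F m, F n, m != n & k = m%:Z - n%:Z]].

Definition delta_ip : set (set nat) :=
  [set B | exists2 F, ip_set F & B = [set k : nat | difference_set F k%:Z]].

Definition delta_ip_star : set (set nat) :=
  [set A | forall B, delta_ip B -> A `&` B !=set0].

Definition return_set (X : Type) (T : X -> X) (U V : set X) : set nat :=
  [set n | (iter n T @` U) `&` V !=set0].

Definition delta_ip_star_transitive (X : topologicalType) (T : X -> X) : Prop :=
  forall U V : set X, open U -> open V -> U !=set0 -> V !=set0 ->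
    delta_ip_star (return_set T U V).

(* Main.v *)
(** By Birkhoff's transitivity theorem it suffices that the return sets of [T]
    from [U1] to [V1] and of [S] from [U2] to [V2] meet. Let [x] have a dense
    [S]-orbit and choose [m0 <= n0] with [S^m0 x] in [U2] and [S^n0 x] in [V2].
    Since [x] is recurrent, its return times to the neighbourhood
    [W = S^-m0 U2 `&` S^-n0 V2] contain an IP-set [F], and
    [n0 - m0 + ((F - F) `&` nat)] consists of return times of [S] from [U2] to
    [V2]: if [a, b] are in [F] and [a > b], then [S^(n0 - m0 + a - b)] maps
    [S^(m0 + b) x] to [S^(n0 + a) x]. The shift is absorbed on the side of [T]
    by applying the hypothesis to [U1] and [T^-(n0 - m0) V1], which is nonempty
    because some return time of [T] from [U1] to [V1] exceeds [n0 - m0]. *)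
Require Import Defs.
From mathcomp Require Import all_boot all_order all_algebra.
From mathcomp Require Import all_classical all_reals all_analysis.
From mathcomp Require Import zify.

Set Implicit Arguments.
Unset Strict Implicit.
Unset Printing Implicit Defensive.

Import Order.TTheory GRing.Theory Num.Theory.
Import numFieldNormedType.Exports.

Local Open Scope classical_set_scope.
Local Open Scope ring_scope.

(** * Complete metrics and Birkhoff's transitivity theorem *)

Definition complete_metric (R : realType) (Z : topologicalType)
    (d : Z -> Z -> R) : Prop :=
  [/\ is_metric d,
      forall (x : Z) (A : set Z),
        nbhs x A <-> exists2 e : R, 0 < e & [set y | d x y < e] `<=` A &
      forall u : nat -> Z,
        (forall e : R, 0 < e -> exists N : nat, forall m n : nat,
           (N <= m)%N -> (N <= n)%N -> d (u m) (u n) < e) ->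
        exists l : Z, u @ \oo --> l].

Lemma continuous_iter (Z : topologicalType) (f : Z -> Z) n : 
  continuous f -> continuous (iter n f).
Proof.
move=> fc; elim: n => [|n IH] x; first exact: cvg_id.
exact: (continuous_comp (IH x) (fc _)).
Qed.

Lemma open_preimage_iter (Z : topologicalType) (f : Z -> Z) n (U : set Z) :
  continuous f -> open U -> open (iter n f @^-1` U).
Proof. by move=> fc; apply: open_comp => x _; exact: continuous_iter. Qed.

Section CompleteMetric.
Variables (R : realType) (Z : topologicalType) (d : Z -> Z -> R).
Hypothesis dP : complete_metric d.

Lemma complete_metric_self x : d x x = 0.
Proof. by case: dP => -[_ h _ _] _ _; apply/h. Qed.

Lemma complete_metric_ball_open x e : open [set y | d x y < e].
Proof.
case: dP => -[_ _ _ dtri] dn _; rewrite openE => y /= xye.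
apply/dn; exists (e - d x y); first by rewrite subr_gt0.
by move=> z /=; rewrite ltrBrDl => /(le_lt_trans (dtri x y z)).
Qed.

Lemma complete_metric_accessible : accessible_space Z.
Proof.
case: dP => -[d0 dE dC _] _ _ x y xy; exists [set z | d x z < d x y].
split; first exact: complete_metric_ball_open.
- rewrite inE /= complete_metric_self lt_neqAle d0 andbT eq_sym.
  by apply: contra_neq xy => /dE.
- by apply/negP; rewrite inE /= ltxx.
Qed.

Lemma complete_metric_closed_ball_lim (u : nat -> Z) (l c : Z) (r : R) :
  u @ \oo --> l -> (\forall n \near \oo, d c (u n) <= r) -> d c l <= r.
Proof.
case: dP => -[_ _ dC dtri] dn _ ul cu; apply/ler_addgt0Pr => e e0.
have lu : \forall n \near \oo, d l (u n) < e.
  by apply: (ul [set y | d l y < e]); apply/dn; exists e.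
have [n [cn ln]] := @filter_ex _ \oo _ _ (filterI cu lu).
by rewrite (le_trans (dtri c (u n) l)) // lerD // dC ltW.
Qed.

(** The base consists of the balls of radius [m.+1%:R^-1] around points of [D], indexed by the code
    of the pair; [B k] is empty when [k] codes no such pair. *)
Lemma separable_countable_base : separable Z -> exists B : nat -> set Z,
  (forall k, open (B k)) /\
  forall x A, nbhs x A -> exists k, B k x /\ B k `<=` A.
Proof.
case: dP => -[_ _ dC dtri] dn _ [D /countable_injP[f finj] Ddense].
pose B k := [set y | exists p m, [/\ D p, d p y < m.+1%:R^-1 &
  pickle (f p, m) = k]].
exists B; split.
  move=> k; rewrite openE => y [p [m [Dp py pmk]]].
  have := complete_metric_ball_open p m.+1%:R^-1; rewrite openE => /(_ y py).
  by apply: filterS => z /= pz; exists p, m.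
move=> x A /dn[e e0 xeA].
have [m _ /(_ m (leqnn m)) mlt] :=
  near_infty_natSinv_lt (PosNum (divr_gt0 e0 (ltr0Sn R 1))).
have m0 : 0 < m.+1%:R^-1 :> R by rewrite invr_gt0.
have [|p [xp Dp]] := Ddense _ _ (complete_metric_ball_open x m.+1%:R^-1).
  by exists x; rewrite /= complete_metric_self.
exists (pickle (f p, m)); split; first by exists p, m; rewrite dC.
move=> y [q [n [Dq qy /(pcan_inj pickleK)[fqp nm]]]].
apply: xeA => /=; rewrite (le_lt_trans (dtri x p y)) // (splitr e).
rewrite ltrD //; first exact: lt_trans xp mlt.
have <- : q = p by apply: finj; rewrite ?inE.
by rewrite (lt_trans qy) // nm.
Qed.

(** A Baire argument: nested closed balls, with radii at least halved at each stage, shrink to a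
    point whose orbit meets every nonempty [B k]. *)
Lemma topologically_transitive_hypercyclic (f : Z -> Z) :
  inhabited Z -> separable Z -> continuous f ->
  (forall U V, open U -> open V -> U !=set0 -> V !=set0 ->
     exists n, return_set f U V n) ->
  hypercyclic f.
Proof.
move=> [z0] /separable_countable_base[B [Bo Bb]] fc ftr.
case: (dP) => -[d0 dE dC dtri] dn dcv.
(* A state [(k, z, r)] stands for the closed ball of center [z] and radius [r]
   at stage [k]; the next ball lies in it and is mapped into [B k] by an iterate
   of [f]. *)
pose P (s t : nat * Z * R) := 0 < s.2 -> [/\ t.1.1 = s.1.1.+1,
  0 < t.2 <= s.2 / 2,
  forall y, d t.1.2 y <= t.2 -> d s.1.2 y <= s.2 &
  B s.1.1 !=set0 -> exists n, forall y, d t.1.2 y <= t.2 ->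
    B s.1.1 (iter n f y)].
have [g gP] : {g & forall s, P s (g s)}.
  apply: choice => -[[k z] r]; rewrite /P /=.
  case: (boolP (0 < r)) => [r0|_]; last by exists (k, z, r).
  pose U := [set y | d z y < r].
  have Uo : open U by exact: complete_metric_ball_open.
  have [w [W [Wo Ww WU WB]]] : exists w W, [/\ open W, W w, W `<=` U &
      B k !=set0 -> exists n, W `<=` iter n f @^-1` B k].
    have Uz : U z by rewrite /U /= complete_metric_self.
    case: (pselect (B k !=set0)) => [Bk|nBk]; last by exists z, U; split.
    have [|n [_ [[w Uw <-] Bw]]] := ftr _ _ Uo (Bo k) _ Bk; first by exists z.
    exists w, (U `&` iter n f @^-1` B k); split => //.
    - by apply: openI => //; exact: open_preimage_iter.
    - by exists n.
  have [e e0 weW] : exists2 e : R, 0 < e & [set y | d w y < e] `<=` W.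
    by apply/dn; exact: open_nbhs_nbhs.
  (* The bound [e / 2] keeps the closed ball inside the open [e]-ball, hence in [W]; [r / 2] makes
     the radii tend to 0. *)
  pose r' := Num.min (e / 2) (r / 2).
  have r'0 : 0 < r' by rewrite lt_min !divr_gt0.
  have cW y : d w y <= r' -> W y.
    move=> wy; apply: weW => /=; rewrite (le_lt_trans wy) // gt_min.
    by rewrite ltr_pdivrMr // ltr_pMr // ltr1n.
  exists (k.+1, w, r') => _; split => //=.
  - by rewrite r'0 /r' ge_min lexx orbT.
  - by move=> y /cW/WU; exact: ltW.
  - by move=> /WB[n Wn]; exists n => y /cW/Wn.
pose s n := iter n g (0%N, z0, 1 : R).
have s0 n : 0 < (s n).2.
  elim: n => [|n IH] /=; first exact: ltr01.
  by have [_ /andP[]] := gP (s n) IH.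
have sk n : (s n).1.1 = n.
  by elim: n => [//|n IH]; have [-> _ _ _] := gP (s n) (s0 n); rewrite IH.
have sr n : (s n).2 <= 2^-1 ^+ n.
  elim: n => [|n IH] /=; first by rewrite expr0.
  have [_ /andP[_ h] _ _] := gP (s n) (s0 n).
  by rewrite (le_trans h) // exprSr ler_pM2r // invr_gt0.
have snest n m y : d (s (n + m)%N).1.2 y <= (s (n + m)%N).2 ->
    d (s n).1.2 y <= (s n).2.
  elim: m => [|m IH]; rewrite ?addn0 // addnS => h; apply: IH.
  by have [_ _ + _] := gP (s (n + m)%N) (s0 _); apply.
have sin n m : (n <= m)%N -> d (s n).1.2 (s m).1.2 <= (s n).2.
  move=> /subnKC <-; apply: (snest _ (m - n)%N).
  by rewrite complete_metric_self ltW.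
have [|l ul] := dcv (fun n => (s n).1.2).
  move=> e e0.
  have : geometric 1 2^-1 @ \oo --> (0 : R).
    by apply: cvg_geometric; rewrite ger0_norm ?invr_ge0 // invf_lt1 // ltr1n.
  move=> /cvgr0Pnorm_lt/(_ (e / 2) (divr_gt0 e0 (ltr0Sn R 1)))[N _ hN].
  (* From stage [N] on, all centers lie in the ball of stage [N], whose radius is below [e / 2]. *)
  exists N => m n Nm Nn.
  have hs : (s N).2 < e / 2.
    rewrite (le_lt_trans (sr N)) //.
    by have := hN N (leqnn N); rewrite /= ger0_norm ?mul1r.
  rewrite (le_lt_trans (dtri _ (s N).1.2 _)) // (splitr e) ltrD //.
    by rewrite dC (le_lt_trans (sin _ _ Nm)).
  by rewrite (le_lt_trans (sin _ _ Nn)).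
have lin n : d (s n).1.2 l <= (s n).2.
  by apply: (complete_metric_closed_ball_lim ul); exists n => // m; exact: sin.
exists l => O [x Ox] Oo.
have [k [Bx BO]] := Bb x O (open_nbhs_nbhs (conj Oo Ox)).
(* The set [B k] is handled in passing from stage [k] to [k.+1], so [l] is used as a point of the
   ball of stage [k.+1]. *)
have [_ _ _] := gP (s k) (s0 k); rewrite sk => -[|n hn]; first by exists x.
exists (iter n f l); split; last by exists n.
by apply/BO/hn; exact: (lin k.+1).
Qed.

End CompleteMetric.

(** * Products of spaces and absence of isolated points *)

Lemma complete_metric_prod (R : realType) (X Y : topologicalType)
    (d1 : X -> X -> R) (d2 : Y -> Y -> R) :
  complete_metric d1 -> complete_metric d2 ->
  complete_metric (fun p q : X * Y => d1 p.1 q.1 + d2 p.2 q.2).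
Proof.
move=> [[p1 e1 c1 t1] n1 k1] [[p2 e2 c2 t2] n2 k2]; split.
- split.
  + by move=> x y; rewrite addr_ge0.
  + move=> [x x'] [y y'] /=; split => [/eqP|[/e1 -> /e2 ->]]; last exact: addr0.
    by rewrite paddr_eq0 // => /andP[/eqP/e1 -> /eqP/e2 ->].
  + by move=> x y; rewrite c1 c2.
  + by move=> x y z; rewrite addrACA lerD.
- move=> [x y] A; split.
  + move=> [[A1 A2] /= [/n1[r1 r10 h1] /n2[r2 r20 h2]] h].
    exists (Num.min r1 r2); first by rewrite lt_min r10.
    move=> [a b] /=; rewrite lt_min => /andP[l1 l2]; apply: h; split => /=.
      by apply: h1 => /=; rewrite (le_lt_trans _ l1) // lerDl.
    by apply: h2 => /=; rewrite (le_lt_trans _ l2) // lerDr.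
  + move=> [e e0 h]; exists ([set a | d1 x a < e / 2], [set b | d2 y b < e / 2]).
      by split => /=; [apply/n1|apply/n2]; exists (e / 2) => //; exact: divr_gt0.
    by move=> [a b] /= [ha hb]; apply: h; rewrite /= (splitr e) ltrD.
- move=> u cu.
  have [|l1 ul1] := k1 (fun n => (u n).1).
    move=> e /cu[N hN]; exists N => m n /hN h /h.
    by apply: le_lt_trans; rewrite lerDl.
  have [|l2 ul2] := k2 (fun n => (u n).2).
    move=> e /cu[N hN]; exists N => m n /hN h /h.
    by apply: le_lt_trans; rewrite lerDr.
  exists (l1, l2).
  rewrite (_ : u = fun n => ((u n).1, (u n).2)); first exact: (cvg_pair ul1 ul2).
  by apply/funext => n; exact: surjective_pairing.
Qed.

Lemma separable_prod (X Y : topologicalType) :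
  separable X -> separable Y -> separable (X * Y)%type.
Proof.
move=> [D cD dD] [E cE dE]; exists (D `*` E); first exact: countableX.
move=> O [[x y] Oxy] Oo.
have [[A B] /= [nA nB] AB] : nbhs (x, y) O by exact: open_nbhs_nbhs.
have [|a [Aa Da]] := dD A^° _ (@open_interior _ _); first by exists x.
have [|b [Bb Eb]] := dE B^° _ (@open_interior _ _); first by exists y.
by exists (a, b); split => //; apply: AB; split; apply: interior_subset.
Qed.

(** Take [v != 0]. If [[set p]] were open, continuity of [t |-> p + t *: v] at 0 would give
    [t *: v = 0] for some [t != 0]. *)
Lemma infinite_dimensional_not_open1 (K : numFieldType) (Y : tvsType K) :
  infinite_dimensional Y -> forall p : Y, ~ open [set p].
Proof.
move=> inf p po.
have [v v0] : exists v : Y, v != 0.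
  apply: contrapT => h; apply: inf; exists 0%N, (fun _ => 0) => x.
  exists (fun _ => 0); rewrite big_ord0.
  by apply/eqP; apply: contrapT => /negP xn; apply: h; exists x.
have cZ : (fun t : K^o => t *: v) @ (0 : K^o) --> (0 : K) *: v.
  apply: (@continuous_comp K^o (K^o * Y)%type Y (fun t => (t, v))
    (fun z => z.1 *: z.2)); last exact: scale_continuous.
  exact: (@cvg_pair _ _ _ (nbhs (0 : K^o)) (nbhs (0 : K^o)) (nbhs v) _ _ _
    id (fun=> v) cvg_id (cvg_cst v)).
have cv : (fun t : K^o => p + t *: v) @ (0 : K^o) --> p + (0 : K) *: v.
  apply: (@continuous_comp K^o (Y * Y)%type Y (fun t => (p, t *: v))
    (fun z => z.1 + z.2)); last exact: add_continuous.
  exact: (@cvg_pair _ _ _ (nbhs (0 : K^o)) (nbhs p) _ _ _ _ (fun=> p) _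
    (cvg_cst p) cZ).
have : nbhs (p + (0 : K) *: v) [set p].
  by rewrite scale0r addr0; exact: open_nbhs_nbhs.
move=> /cv h.
have h0 : \forall t \near (0 : K^o), p + t *: v = p by exact: h.
have h1 : \forall t \near (0 : K^o)^', p + t *: v = p.
  by rewrite near_withinE; apply: filterS h0.
have [t [/= t0 tv]] := filter_ex (filterI (nbhs_dnbhs_neq (0 : K^o)) h1).
move: tv => /eqP; rewrite -[X in _ == X]addr0 (inj_eq (addrI p)) scaler_eq0.
by rewrite (negbTE t0) (negbTE v0).
Qed.

(** * Late visits, recurrence and IP-sets of return times *)

Section Orbits.
Variables (Z : topologicalType) (f : Z -> Z).

(** Finite sets are closed and no point is isolated, so [W] minus the first [N] orbit points is
    still open and nonempty; the orbit can meet it only at a time at least [N]. *)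
Lemma dense_orbit_visits_late x : accessible_space Z ->
  (forall p : Z, ~ open [set p]) ->
  dense [set iter n f x | n in [set: nat]] ->
  forall N W, open W -> W !=set0 -> exists2 n, (N <= n)%N & W (iter n f x).
Proof.
move=> acc perf dx N W Wo W0.
have open_minus M : open (W `&` ~` [set iter n f x | n in `I_M]).
  apply: openI => //; apply: closed_openC.
  apply: (accessible_finite_set_closed.1 acc); exact/finite_image/finite_II.
have nonempty_minus M : W `&` ~` [set iter n f x | n in `I_M] !=set0.
  elim: M => [|M [y My]]; first by case: W0 => y Wy; exists y; split => // -[].
  apply: contrapT => h; apply: (perf (iter M f x)).
  (* If removing one more orbit point emptied the set, that point alone would have formed an open
     set. *)
  suff <- : W `&` ~` [set iter n f x | n in `I_M] = [set iter M f x] by [].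
  have sub z : (W `&` ~` [set iter n f x | n in `I_M]) z -> z = iter M f x.
    move=> [Wz nz]; apply: contrapT => zM; apply: h; exists z; split => //.
    move=> [i /=]; rewrite ltnS leq_eqVlt => /orP[/eqP -> zE|iM iz].
      exact: zM.
    by apply: nz; exists i.
  by apply/seteqP; split => [z /sub //|z ->]; rewrite -(sub y).
have [y [[Wy ny] [n _ nxy]]] := dx _ (nonempty_minus N) (open_minus N).
exists n; last by rewrite nxy.
by rewrite leqNgt; apply/negP => nN; apply: ny; exists n.
Qed.

Lemma recurrent_ip_set x : continuous f ->
  (forall W, open W -> W x -> exists2 n, n != 0%N & W (iter n f x)) ->
  forall W, open W -> W x -> ip_set [set n | W (iter n f x)].
Proof.
move=> fc rec W Wo Wx.
have [g gP] : {g : set Z -> nat & forall V, open V -> V x ->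
    g V != 0%N /\ V (iter (g V) f x)}.
  apply: (@choice _ _ (fun V n => open V -> V x ->
    n != 0%N /\ V (iter n f x))) => V.
  case: (pselect (open V /\ V x)) => [[Vo Vx]|h].
    by have [n] := rec V Vo Vx; exists n.
  by exists 0%N => Vo Vx; case: h.
(* Furstenberg's construction: [V k] is a decreasing sequence of neighbourhoods
   of [x], and the time [g (V k)] maps [V k.+1] into [V k]. *)
pose V k := iter k (fun U => U `&` iter (g U) f @^-1` U) W.
have VP k : open (V k) /\ V k x.
  elim: k => [//|k [Vo Vx]] /=; split; last by split; have [] := gP _ Vo Vx.
  by apply: openI => //; exact: open_preimage_iter.
have Vle i j : (i <= j)%N -> V j `<=` V i.
  move=> /subnKC <-; elim: (j - i)%N => [|k IH]; rewrite ?addn0 // addnS.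
  by move=> y [/IH].
exists (fun k => g (V k)).
  rewrite (_ : [set n | _] = setT); first exact: infinite_nat.
  by apply/seteqP; split => // k _; have [Vo Vx] := VP k; have [] := gP _ Vo Vx.
move=> _ [s [+ +] ->]; case: s => [//|i s] _ /= ils.
(* For the induction, the orbit point is placed in [V i], with [i] the least index of the sum: the
   remaining sum leads into [V j], which lies in [V i.+1] as [i < j], and [g (V i)] maps this into
   [V i]. *)
apply: (Vle 0%N i) => //.
elim: s i ils => [|j s IH] i /=.
  by rewrite big_seq1 => _; have [Vo Vx] := VP i; have [] := gP _ Vo Vx.
move=> /andP[ij /IH]; rewrite [in X in _ -> X]big_cons iterD.
by move=> /(Vle i.+1 j ij)[].
Qed.

Lemma delta_ip_star_transitive_late : delta_ip_star_transitive f ->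
  forall N U V, open U -> open V -> U !=set0 -> V !=set0 ->
  exists2 n, (N <= n)%N & return_set f U V n.
Proof.
move=> ftr N U V Uo Vo U0 V0.
(* All finite sums are multiples of [N.+1], hence so are their differences. *)
pose F := FS (fun=> N.+1).
have Fip : ip_set F.
  exists (fun=> N.+1) => //.
  by rewrite (_ : [set n | _] = setT); [exact: infinite_nat|apply/seteqP].
have FM a : F a -> (N.+1 %| a)%N.
  move=> [s _ ->]; rewrite big_const_seq iter_addn_0.
  exact: dvdn_mulr.
have [|n [Rn [a [b [/FM Fa /FM Fb ab nab]]]]] := ftr U V Uo Vo U0 V0
    [set k : nat | difference_set F k%:Z].
  by exists F.
exists n => //.
have nE : n = (a - b)%N by lia.
have : (N.+1 %| n)%N by rewrite nE dvdn_sub.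
(* Since [a != b], the multiple [n] of [N.+1] is positive. *)
by move=> /dvdn_leq h; apply/ltnW/h; lia.
Qed.

End Orbits.

(** * Common return times and the conclusion *)

Lemma delta_ip_star_transitive_hypercyclic_returns (X Y : topologicalType)
    (T : X -> X) (S : Y -> Y) :
  continuous T -> continuous S -> delta_ip_star_transitive T ->
  accessible_space Y -> (forall p : Y, ~ open [set p]) -> hypercyclic S ->
  forall (U1 V1 : set X) (U2 V2 : set Y),
    open U1 -> open V1 -> U1 !=set0 -> V1 !=set0 ->
    open U2 -> open V2 -> U2 !=set0 -> V2 !=set0 ->
  exists n, return_set T U1 V1 n /\ return_set S U2 V2 n.
Proof.
move=> Tc Sc Ttr acc perf [x dx] U1 V1 U2 V2 U1o V1o U10 V10 U2o V2o U20 V20.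
have late := dense_orbit_visits_late acc perf dx.
have [m0 _ Um0] := late 0%N _ U2o U20.
(* Asking for [m0 <= n0] makes the truncated difference [n0 - m0] a true one. *)
have [n0 mn0 Vn0] := late m0 _ V2o V20.
pose W := iter m0 S @^-1` U2 `&` iter n0 S @^-1` V2.
have Wo : open W by apply: openI; exact: open_preimage_iter.
have Fip : ip_set [set n | W (iter n S x)].
  apply: recurrent_ip_set => // O Oo Ox.
  by have [|n n0' On] := late 1%N O Oo; [exists x|exists n; rewrite -?lt0n].
have preV10 : iter (n0 - m0) T @^-1` V1 !=set0.
  have [k kge [_ [[u _ <-] Vu]]] :=
    delta_ip_star_transitive_late Ttr (n0 - m0)%N U1o V1o U10 V10.
  exists (iter (k - (n0 - m0)) T u).
  by rewrite /preimage /= -iterD subnKC.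
have [|k [[_ [[u Uu <-] Vu]] [a [b [[_ Wa] [Wb _] ab kab]]]]] :=
    Ttr _ _ U1o (open_preimage_iter (n0 - m0) Tc V1o) U10 preV10
    [set k : nat | difference_set [set n | W (iter n S x)] k%:Z].
  by exists [set n | W (iter n S x)].
have aE : a = (k + b)%N by lia.
exists (n0 - m0 + k)%N; split.
  by exists (iter (n0 - m0 + k) T u); split; [exists u|rewrite iterD].
(* As [a = k + b], the times [n0 + a] and [(n0 - m0 + k) + (m0 + b)] agree. *)
exists (iter n0 S (iter a S x)); split => //.
exists (iter m0 S (iter b S x)) => //.
by rewrite -!iterD; congr (iter _ S x); lia.
Qed.

Theorem proposition3p15 (R : realType) (K : numFieldType)
    (hK : real_or_complex R K) (X : tvsType K) (hX : operator_space R X)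
    (T : {linear X -> X}) (hT : continuous T)
    (htrans : delta_ip_star_transitive T) :
  mildly_mixing R T.
Proof.
move=> Y S [[dY [dY1 _ dY2 dY3]] sepY infY] Sc Shyp.
case: hX => -[dX [dX1 _ dX2 dX3]] sepX _.
have cX : complete_metric dX by [].
have cY : complete_metric dY by [].
apply: (@topologically_transitive_hypercyclic R _ _
  (complete_metric_prod cX cY)).
- exact: (inhabits (0, 0)).
- exact: separable_prod.
- move=> z; apply: cvg_pair.
    by apply: continuous_comp; [exact: cvg_fst|exact: hT].
  by apply: continuous_comp; [exact: cvg_snd|exact: Sc].
move=> U V Uo Vo [[u1 u2] Uu] [[v1 v2] Vv].
(* It is enough to treat open boxes inside [U] and [V], where a return of the sum is a common return
   of [T] and [S]. *)
have [[A1 A2] /= [nA1 nA2] AU] : nbhs (u1, u2) U by exact: open_nbhs_nbhs.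
have [[B1 B2] /= [nB1 nB2] BV] : nbhs (v1, v2) V by exact: open_nbhs_nbhs.
have [||||n [[_ [[a1 Aa1 <-] Ba1]] [_ [[a2 Aa2 <-] Ba2]]]] :=
  @delta_ip_star_transitive_hypercyclic_returns X Y T S hT Sc htrans
    (complete_metric_accessible cY) (infinite_dimensional_not_open1 infY) Shyp
    A1^° B1^° A2^° B2^° (@open_interior _ _) (@open_interior _ _) _ _
    (@open_interior _ _) (@open_interior _ _).
- by exists u1.
- by exists v1.
- by exists u2.
- by exists v2.
exists n, (iter n T a1, iter n S a2); split; last first.
  by apply: BV; split; apply: interior_subset.
exists (a1, a2); first by apply: AU; split; apply: interior_subset.
by elim: n {Ba1 Ba2} => //= n ->.
Qed.
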